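(* Let $c>0$. Let $L:\mathbb{R}_+\times[0,c)\to\mathbb{R}_+$ be a surjective function satisfying the basic hypotheses (defined in the context), and let $\oplus:[0,c)\times[0,c)\to[0,c)$ be an operation which has $0$ as its identity element and which is continuous and strictly increasing in both variables. Then the following three conditions are equivalent: [R] For all $\lambda\in\mathbb{R}_+$ and $v,w\in[0,c)$: $L(L(\lambda,v),w)=L(\lambda,v\oplus w)$. [D$^\dagger$] & [A$^\dagger$] There exist a continuous strictly increasing function $u$ mapping $[0,c)$ onto $[0,c)$ and a constant $\xi>0$ such that (with the same function $u$ in both formulas), for all $\lambda\in\mathbb{R}_+$ and $v,w\in[0,c)$, $$L(\lambda,v)=\lambda\left(\frac{c-u(v)}{c+u(v)}\right)^{\xi}\qquad\text{and}\qquad v\oplus w=u^{-1}\left(\frac{u(v)+u(w)}{1+\frac{u(v)u(w)}{c^2}}\right).$$ [M] For all $\lambda,\lambda'\in\mathbb{R}_+$ and $v,v',w\in[0,c)$: $L(\lambda,v)\le L(\lambda',v')$ if and only if $L(\lambda,v\oplus w)\le L(\lambda',v'\oplus w)$.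
   Context: $\mathbb{R}_+$ denotes the set of strictly positive real numbers. A surjective function $L:\mathbb{R}_+\times[0,c)\to\mathbb{R}_+$ satisfies the \emph{basic hypotheses} if: (1) $L$ is strictly increasing in the first variable, strictly decreasing in the second variable, and continuous in both variables; (2) $L$ satisfies left order-invariance with respect to similarity transformations [LOI]: for all $x,z\in\mathbb{R}_+$, all $a>0$ and all $y,w\in[0,c)$, $L(x,y)\le L(z,w)$ if and only if $L(ax,y)\le L(az,w)$; (3) $L(\lambda,0)=\lambda$ for all $\lambda\in\mathbb{R}_+$. An operation $\oplus$ on $[0,c)$ has $0$ as its identity element if $0\oplus v=v\oplus 0=v$ for all $v\in[0,c)$. *)

(* Defs.v *)
From mathcomp Require Import all_boot all_order all_algebra.
From mathcomp Require Import all_classical all_reals all_analysis.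

Set Implicit Arguments.
Unset Strict Implicit.
Unset Printing Implicit Defensive.

Import Order.TTheory GRing.Theory Num.Theory.
Import numFieldNormedType.Exports.

Local Open Scope classical_set_scope.
Local Open Scope ring_scope.

(* A function whose domain is a proper subset of R (or of R * R) is a total
   function, constrained and used only on that domain; its values elsewhere
   are irrelevant. *)

Section Notions.
Context {R : realType}.
Implicit Types (c xi a x y z v w lambda : R).
Implicit Types (L op : R -> R -> R) (u : R -> R).

Definition surjective_onto_Rpos c L : Prop :=
  let D := `]0, +oo[%classic `*` `[0, c[%classic in
  set_fun D `]0, +oo[%classic (uncurry L) /\
  set_surj D `]0, +oo[%classic (uncurry L).

(* Continuity is required in each variable separately. For functions that are
   strictly monotonic in each variable, this amounts to joint continuity. *)
Record basic_hypotheses c L : Prop := BasicHypotheses {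
  basic_increasing : forall y, y \in `[0, c[ ->
    {in `]0, +oo[ &, {homo L^~ y : x z / x < z}};
  basic_decreasing : forall x, x \in `]0, +oo[ ->
    {in `[0, c[ &, {homo L x : y w /~ y < w}};
  basic_continuous_l : forall y, y \in `[0, c[ ->
    {within `]0, +oo[%classic, continuous (L^~ y)};
  basic_continuous_r : forall x, x \in `]0, +oo[ ->
    {within `[0, c[%classic, continuous (L x)};
  basic_LOI : forall x z a y w,
    x \in `]0, +oo[ -> z \in `]0, +oo[ -> 0 < a ->
    y \in `[0, c[ -> w \in `[0, c[ ->
    L x y <= L z w <-> L (a * x) y <= L (a * z) w;
  basic_id : forall lambda, lambda \in `]0, +oo[ -> L lambda 0 = lambda
}.

Definition operation_on c op : Prop :=
  forall v w, v \in `[0, c[ -> w \in `[0, c[ -> op v w \in `[0, c[.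

Definition zero_identity c op : Prop :=
  forall v, v \in `[0, c[ -> op 0 v = v /\ op v 0 = v.

Record continuous_increasing c op : Prop := ContinuousIncreasing {
  op_increasing_l : forall w, w \in `[0, c[ ->
    {in `[0, c[ &, {homo op^~ w : v v' / v < v'}};
  op_increasing_r : forall v, v \in `[0, c[ ->
    {in `[0, c[ &, {homo op v : w w' / w < w'}};
  op_continuous_l : forall w, w \in `[0, c[ ->
    {within `[0, c[%classic, continuous (op^~ w)};
  op_continuous_r : forall v, v \in `[0, c[ ->
    {within `[0, c[%classic, continuous (op v)}
}.

Definition condR c L op : Prop :=
  forall lambda v w,
    lambda \in `]0, +oo[ -> v \in `[0, c[ -> w \in `[0, c[ ->
    L (L lambda v) w = L lambda (op v w).

Definition condM c L op : Prop :=
  forall lambda lambda' v v' w,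
    lambda \in `]0, +oo[ -> lambda' \in `]0, +oo[ ->
    v \in `[0, c[ -> v' \in `[0, c[ -> w \in `[0, c[ ->
    L lambda v <= L lambda' v' <-> L lambda (op v w) <= L lambda' (op v' w).

Record scale_function c u : Prop := ScaleFunction {
  scale_continuous : {within `[0, c[%classic, continuous u};
  scale_increasing : {in `[0, c[ &, {homo u : v w / v < w}};
  scale_fun : set_fun `[0, c[%classic `[0, c[%classic u;
  scale_surj : set_surj `[0, c[%classic `[0, c[%classic u
}.

Definition condD c L u xi : Prop :=
  forall lambda v, lambda \in `]0, +oo[ -> v \in `[0, c[ ->
    L lambda v = lambda * ((c - u v) / (c + u v)) `^ xi.

(* The partial inverse of u on `[0, c[; its default value 0 is never used, as u
   maps `[0, c[ onto itself and the argument lies in `[0, c[. *)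
Definition condA c op u : Prop :=
  forall v w, v \in `[0, c[ -> w \in `[0, c[ ->
    op v w = 'pinv_(fun=> 0) `[0, c[%classic u
               ((u v + u w) / (1 + u v * u w / c ^+ 2)).

Definition condDA c L op : Prop :=
  exists u xi, [/\ scale_function c u, 0 < xi, condD c L u xi & condA c op u].

End Notions.

(* Main.v *)
(** Applying [LOI] with [w = 0] gives [L lambda v = lambda * f v], where
    [f := L 1] is continuous and strictly decreasing with [f 0 = 1]. Both [R]
    and [M] then say that [f (op v w) = f v * f w]. In that case the values of
    [f] include all powers of some [q < 1], so by continuity they fill the
    whole interval from 0 (excluded) to 1, and the formulas hold with [xi = 1]
    and [u := c * (1 - f) / (1 + f)], since [s |-> (c - s) / (c + s)] turns
    relativistic addition into multiplication. *)
Require Import Defs.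
From mathcomp Require Import all_boot all_order all_algebra.
From mathcomp Require Import all_classical all_reals all_analysis.
From mathcomp Require Import ring lra.
Import Order.TTheory GRing.Theory Num.Theory.
Import numFieldNormedType.Exports.
Local Open Scope classical_set_scope.
Local Open Scope ring_scope.

(** * Relativistic addition of velocities and the Doppler factor *)

Section Velocity.
Context {R : realType}.
Implicit Types (c t s a b : R).

Definition velocity_add c a b : R := (a + b) / (1 + a * b / c ^+ 2).

Lemma velocity_addE c a b : 0 < c -> 0 <= a -> 0 <= b ->
  velocity_add c a b = c ^+ 2 * (a + b) / (c ^+ 2 + a * b).
Proof.
move=> c0 a0 b0; rewrite /velocity_add.
have ab0 : 0 <= a * b by rewrite mulr_ge0.
have c20 : 0 < c ^+ 2 by rewrite exprn_gt0.
by field; rewrite !gt_eqF //; lra.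
Qed.

Lemma velocity_add_itv c a b : 0 < c -> a \in `[0, c[ -> b \in `[0, c[ ->
  velocity_add c a b \in `[0, c[.
Proof.
move=> c0; rewrite !in_itv/= => /andP[a0 ac] /andP[b0 bc].
rewrite velocity_addE//.
have ab0 : 0 <= a * b by rewrite mulr_ge0.
have c20 : 0 < c ^+ 2 by rewrite exprn_gt0.
have d0 : 0 < c ^+ 2 + a * b by lra.
rewrite divr_ge0 ?mulr_ge0 ?addr_ge0//= ?ltW//.
rewrite ltr_pdivrMr// -subr_gt0.
(* The gap to [c] factors through the gaps [c - a] and [c - b], so the sum stays below [c]. *)
have -> : c * (c ^+ 2 + a * b) - c ^+ 2 * (a + b) = c * ((c - a) * (c - b)).
  by ring.
by rewrite !mulr_gt0// subr_gt0.
Qed.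

(** The square of the relativistic Doppler factor. For [s = c * tanh r], with [r] the rapidity, it
    equals [exp (- 2 * r)]. *)
Definition doppler c s : R := (c - s) / (c + s).

Lemma doppler_ge0 c s : s \in `[0, c[ -> 0 <= doppler c s.
Proof.
rewrite in_itv/= => /andP[s0 sc].
by rewrite divr_ge0 //; lra.
Qed.

(** Rapidities add, so their exponentials multiply. Algebraically, [c * (c ^+ 2 + a * b)] plus or
    minus [c ^+ 2 * (a + b)] splits as [c] times the product of the [c + a], [c + b], respectively
    [c - a], [c - b]. *)
Lemma doppler_velocity_add c a b :
  0 < c -> a \in `[0, c[ -> b \in `[0, c[ ->
  doppler c (velocity_add c a b) = doppler c a * doppler c b.
Proof.
move=> c0; rewrite !in_itv/= => /andP[a0 ac] /andP[b0 bc].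
rewrite velocity_addE// /doppler.
have ab0 : 0 <= a * b by rewrite mulr_ge0.
have c20 : 0 < c ^+ 2 by rewrite exprn_gt0.
have cab0 : 0 <= c * (a + b) by rewrite mulr_ge0; lra.
(* The denominator left after clearing the inner fraction; its factored form shows that it is
   nonzero, as [field] requires. *)
have E : c * (c ^+ 2 + a * b) + c ^+ 2 * (a + b) = c * ((c + a) * (c + b)).
  by ring.
have cacb : 0 < c * ((c + a) * (c + b)) by rewrite !mulr_gt0 //; lra.
by field; rewrite ?E !gt_eqF //; lra.
Qed.

Definition inv_doppler c t : R := c * (1 - t) / (1 + t).

Lemma inv_dopplerK c t : 0 < c -> 0 < t -> doppler c (inv_doppler c t) = t.
Proof.
move=> c0 t0; rewrite /doppler /inv_doppler.
have E : c * (1 + t) + c * (1 - t) = 2 * c by ring.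
by field; rewrite ?E !gt_eqF //; lra.
Qed.

Lemma dopplerK c s : 0 < c -> 0 <= s -> inv_doppler c (doppler c s) = s.
Proof.
move=> c0 s0; rewrite /doppler /inv_doppler.
have E : c + s + (c - s) = 2 * c by ring.
by field; rewrite ?E !gt_eqF //; lra.
Qed.

Lemma inv_doppler_lt c t t' :
  0 < c -> 0 < t' -> t' < t -> inv_doppler c t < inv_doppler c t'.
Proof.
move=> c0 t'0 t't; rewrite /inv_doppler.
rewrite ltr_pdivrMr; last lra.
rewrite mulrAC ltr_pdivlMr; last lra.
by rewrite -!mulrA ltr_pM2l//; nra.
Qed.

Lemma inv_doppler_itv c t : 0 < c -> 0 < t -> t <= 1 ->
  inv_doppler c t \in `[0, c[.
Proof.
move=> c0 t0 t1; rewrite in_itv/= /inv_doppler.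
rewrite divr_ge0 ?mulr_ge0 /=; [|lra..].
by rewrite ltr_pdivrMr ?ltr_pM2l//; lra.
Qed.

Lemma doppler_itv c s : s \in `[0, c[ -> 0 < doppler c s <= 1.
Proof.
rewrite in_itv/= => /andP[s0 sc]; rewrite /doppler.
by rewrite divr_gt0 ?ler_pdivrMr /=; lra.
Qed.

End Velocity.

(** * Decreasing functions on [[0, c[] that turn [op] into multiplication *)

Section MultiplicativeFunction.
Context {R : realType} {c : R} (hc : 0 < c) {op : R -> R -> R}.
Hypothesis hop : operation_on c op.

Lemma mem0c : 0 \in `[0, c[.
Proof. by rewrite in_itv/= lexx. Qed.

(** Iterating [op v] from [0] never leaves [[0, c[]. This produces arbitrarily small values of [f]
    although no limit of [f] at [c] is assumed. *)
Lemma multiplicative_power (f : R -> R) v n :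
  f 0 = 1 -> v \in `[0, c[ ->
  {in `[0, c[ &, forall v w, f (op v w) = f v * f w} ->
  exists2 w, w \in `[0, c[ & f w = f v ^+ n.
Proof.
move=> f0 vc fM; elim: n => [|n [w wc fw]].
  by exists 0; rewrite ?mem0c ?expr0.
by exists (op v w); [exact: hop|rewrite fM// fw exprS].
Qed.

Lemma multiplicative_onto (f : R -> R) t :
  f 0 = 1 -> {in `[0, c[, forall v, 0 < f v} ->
  {in `[0, c[ &, {homo f : v w /~ v < w}} ->
  {within `[0, c[, continuous f} ->
  {in `[0, c[ &, forall v w, f (op v w) = f v * f w} ->
  0 < t <= 1 -> exists2 v, v \in `[0, c[ & f v = t.
Proof.
have c0 := hc; move=> f0 fpos fdecr fcont fM /andP[t0 t1].
(* Any interior point would do: all that matters is that [f] lies strictly between 0 and 1 there. *)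
have hc2 : c / 2 \in `[0, c[ by rewrite in_itv/=; apply/andP; split; lra.
have q0 := fpos _ hc2.
have q1 : f (c / 2) < 1.
  by rewrite -[ltRHS]f0; apply: fdecr; rewrite ?mem0c//; lra.
have [n qn] : exists n, f (c / 2) ^+ n < t.
  have /cvgrPdist_lt/(_ _ t0)[n _ /(_ n (leqnn n))] :
      (fun n => f (c / 2) ^+ n) @ \oo --> 0.
    by apply: cvg_expr; rewrite gtr0_norm.
  rewrite /= sub0r normrN ger0_norm ?exprn_ge0 ?ltW// => ?.
  by exists n.
have [w wc fw] := @multiplicative_power f _ n f0 hc2 fM.
move: (wc); rewrite in_itv/= => /andP[w0 wltc].
have sub : `[0, w] `<=` `[0, c[.
  by move=> x /=; rewrite !in_itv/= => /andP[-> xw]; exact: le_lt_trans wltc.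
(* Now [t] lies between [f w], a power below [t], and [f 0 = 1]. *)
have [|x xw fx] := IVT w0 (continuous_subspaceW sub fcont) (v := t).
  by rewrite f0 fw ge_min le_max t1 (ltW qn) orbT.
by exists x => //; exact: sub xw.
Qed.

Lemma scale_inv_doppler (f : R -> R) :
  f 0 = 1 -> {in `[0, c[, forall v, 0 < f v} ->
  {in `[0, c[ &, {homo f : v w /~ v < w}} ->
  {within `[0, c[, continuous f} ->
  {in `[0, c[ &, forall v w, f (op v w) = f v * f w} ->
  scale_function c (inv_doppler c \o f).
Proof.
move=> f0 fpos fdecr fcont fM.
have fle1 v : v \in `[0, c[ -> f v <= 1.
  move=> vc; move: (vc); rewrite in_itv/= le_eqVlt => /andP[/orP[/eqP<-|v0] _].
    by rewrite f0.
  by rewrite -f0; apply/ltW/fdecr; rewrite ?mem0c.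
split.
- apply/subspace_continuousP => x /= xc.
  have fx := (subspace_continuousP _ _).1 fcont x xc.
  have f0x := fpos _ xc.
  apply: cvgM.
    by apply: cvgM; [exact: cvg_cst|apply: cvgB => //; exact: cvg_cst].
  apply: cvgV; first by rewrite gt_eqF//; lra.
  by apply: cvgD => //; exact: cvg_cst.
- move=> v w vc wc vw /=.
  by apply: inv_doppler_lt => //; [exact: fpos|exact: fdecr].
- by move=> v /= vc; apply: inv_doppler_itv; rewrite ?fpos ?fle1.
(* Surjectivity: a preimage of [s] is a point where [f] takes the value [doppler c s], which lies in
   the range of [f]. *)
- move=> s /= sc.
  have [v vc fv] :=
    multiplicative_onto _ _ f0 fpos fdecr fcont fM (doppler_itv c s sc).
  exists v => //=; rewrite fv dopplerK//.
  by move: sc; rewrite in_itv/= => /andP[].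
Qed.

End MultiplicativeFunction.

(** * Reduction of the three conditions to a functional equation for [L 1] *)

Section Aberration.
Context {R : realType} {c : R} (hc : 0 < c) {L op : R -> R -> R}.
Hypotheses (hLsurj : surjective_onto_Rpos c L) (hL : basic_hypotheses c L).
Hypotheses (hop : operation_on c op) (hop0 : zero_identity c op).

Let pos (x : R) : (x \in `]0, +oo[) = (0 < x).
Proof. by rewrite in_itv/= andbT. Qed.

Lemma basic_pos x v : 0 < x -> v \in `[0, c[ -> 0 < L x v.
Proof.
move=> x0 vc; have [+ _] := hLsurj.
by move=> /(_ (x, v)); rewrite /= !in_itv/= !andbT; apply; split => //=.
Qed.

(** Since [L (L 1 v) 0 = L 1 v], the pairs [(1, v)] and [(L 1 v, 0)] have the same image. [LOI],
    used in both directions of the inequality, keeps the images equal after scaling by [x]. *)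
Lemma basic_homogeneous x v : 0 < x -> v \in `[0, c[ -> L x v = x * L 1 v.
Proof.
move=> x0 vc; have f0 := basic_pos 1 v ltr01 vc.
have id y : 0 < y -> L y 0 = y by rewrite -pos; exact: (basic_id hL).
have m0 := mem0c hc.
have p1 : (1 : R) \in `]0, +oo[ by rewrite pos.
have pf : L 1 v \in `]0, +oo[ by rewrite pos.
have h1 := basic_LOI hL p1 pf x0 vc m0.
have h2 := basic_LOI hL pf p1 x0 m0 vc.
rewrite !id ?mulr_gt0// mulr1 in h1 h2.
by apply/eqP; rewrite eq_le; apply/andP; split; [apply/h1|apply/h2].
Qed.

Let multiplicative := {in `[0, c[ &, forall v w, L 1 (op v w) = L 1 v * L 1 w}.

Lemma condR_multiplicative : condR c L op <-> multiplicative.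
Proof.
split=> [H v w vc wc|H x v w].
  by rewrite -H ?pos// basic_homogeneous// basic_pos.
rewrite pos => x0 vc wc; rewrite basic_homogeneous ?basic_pos//.
rewrite (basic_homogeneous x v)// (basic_homogeneous x (op v w)) ?hop//.
by rewrite H// mulrA.
Qed.

Lemma condM_multiplicative : condM c L op <-> multiplicative.
Proof.
have m0 := mem0c hc.
split=> [H v w vc wc|H x x' v v' w].
  have f0 := basic_pos 1 v ltr01 vc.
  have p1 : (1 : R) \in `]0, +oo[ by rewrite pos.
  have pf : L 1 v \in `]0, +oo[ by rewrite pos.
  (* The pairs [(1, v)] and [(L 1 v, 0)] again have equal images; [M] lets [w] be added to both, and
     [op 0 w = w] gives [L 1 v * L 1 w] on the second side. *)
  have h1 := H _ _ _ _ _ p1 pf vc m0 wc.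
  have h2 := H _ _ _ _ _ pf p1 m0 vc wc.
  rewrite (basic_id hL pf) (hop0 w wc).1 (basic_homogeneous _ w f0 wc) in h1 h2.
  by apply/eqP; rewrite eq_le; apply/andP; split; [apply/h1|apply/h2].
rewrite !pos => x0 x'0 vc v'c wc.
rewrite (basic_homogeneous x v)// (basic_homogeneous x' v')//.
rewrite (basic_homogeneous x (op v w)) ?hop//.
rewrite (basic_homogeneous x' (op v' w)) ?hop//.
(* Adding [w] multiplies both sides by the positive factor [L 1 w], which cancels. *)
by rewrite !H// !mulrA ler_pM2r// basic_pos.
Qed.

Lemma multiplicative_condDA : multiplicative -> condDA c L op.
Proof.
move=> H.
have p1 : (1 : R) \in `]0, +oo[ by rewrite pos.
have f0 : L 1 0 = 1 by exact: (basic_id hL).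
have fpos : {in `[0, c[, forall v, 0 < L 1 v} by move=> v; exact: basic_pos.
have fdecr : {in `[0, c[ &, {homo L 1 : v w /~ v < w}}.
  exact: (basic_decreasing hL p1).
have fcont := basic_continuous_r hL p1.
have su := scale_inv_doppler hc hop _ f0 fpos fdecr fcont H.
exists (inv_doppler c \o L 1), 1; split=> // [x v|v w vc wc].
  rewrite pos => x0 vc.
  rewrite basic_homogeneous// -[_ / _]/(doppler c (inv_doppler c (L 1 v))).
  by rewrite inv_dopplerK ?fpos// powRr1// ltW// fpos.
(* Injectivity lets the partial inverse cancel [u], once its argument is recognised as
   [u (op v w)]. *)
have uinj : {in `[0, c[%classic &, injective (inv_doppler c \o L 1)}.
  move=> x y; rewrite !inE/=.
  exact: (inc_inj_in (le_mono_in (scale_increasing su))).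
rewrite -[X in 'pinv_ _ _ _ X]/(velocity_add c _ _).
have -> : velocity_add c (inv_doppler c (L 1 v)) (inv_doppler c (L 1 w))
    = (inv_doppler c \o L 1) (op v w).
  have uv := scale_fun su vc; have uw := scale_fun su wc.
  (* Both factors are rewritten as Doppler factors of [u v] and [u w], so that their product is the
     Doppler factor of the relativistic sum. *)
  rewrite /= H// -[in RHS](inv_dopplerK c (L 1 v))// ?fpos//.
  rewrite -[L 1 w in RHS](inv_dopplerK c (L 1 w))// ?fpos//.
  rewrite -doppler_velocity_add// dopplerK//.
  by have := velocity_add_itv _ _ _ hc uv uw; rewrite in_itv/= => /andP[].
by rewrite pinvKV// inE; exact: hop.
Qed.

Lemma condDA_multiplicative : condDA c L op -> multiplicative.
Proof.
move=> [u [xi [su xi0 hD hA]]] v w vc wc.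
have uv : u v \in `[0, c[ := scale_fun su vc.
have uw : u w \in `[0, c[ := scale_fun su wc.
have p1 : (1 : R) \in `]0, +oo[ by rewrite pos.
have uop : u (op v w) = velocity_add c (u v) (u w).
  (* As [u] is onto, its partial inverse is a right inverse on [[0, c[], where the relativistic sum
     lies. *)
  rewrite hA//; apply: (surjpK _ (scale_surj su)).
  by rewrite inE; exact: velocity_add_itv.
rewrite !hD ?hop// !mul1r uop -!/(doppler _ _).
by rewrite doppler_velocity_add// powRM// doppler_ge0.
Qed.

End Aberration.

Theorem theorem6 (R : realType) (c : R) (hc : 0 < c)
    (L : R -> R -> R) (hLsurj : surjective_onto_Rpos c L)
    (hL : basic_hypotheses c L)
    (op : R -> R -> R) (hop : operation_on c op) (hop0 : zero_identity c op)
    (hopc : continuous_increasing c op) :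
  (condR c L op <-> condDA c L op) /\ (condDA c L op <-> condM c L op).
Proof.
have DA : condDA c L op <->
    {in `[0, c[ &, forall v w, L 1 (op v w) = L 1 v * L 1 w}.
  by split; [exact: condDA_multiplicative|exact: multiplicative_condDA].
split; rewrite DA; first exact (condR_multiplicative hc hLsurj hL hop).
exact (iff_sym (condM_multiplicative hc hLsurj hL hop hop0)).
Qed.
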